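(* Let $s>0$ and let $(\lambda,\mu,\nu,\rho,\sigma,\tau)\in\mathbb R_{\ge0}^6$ be a 6-tuple of nonnegative real numbers solving the $n=2$ multiplicative multiple Horn problem with parameter $s$, i.e. there exist $A,B,C\in\mathrm{SU}(2)^*$ such that the singular values of $A,B,C,AB,BC,ABC$ are $e^{\pm s\lambda},e^{\pm s\mu},e^{\pm s\nu},e^{\pm s\rho},e^{\pm s\sigma},e^{\pm s\tau}$, respectively. Put $\alpha=\lambda+\nu$, $\beta=\mu+\tau$, $\gamma=\rho+\sigma$. Then $$\alpha<\max\{\beta,\gamma\}+s^{-1}\log 16,\qquad \beta<\max\{\alpha,\gamma\}+s^{-1}\log16,\qquad \gamma<\max\{\alpha,\beta\}+s^{-1}\log16.$$
   Context: $\mathrm{SU}(2)^*$ denotes the group of matrices $\begin{bmatrix}u&0\\ v&u^{-1}\end{bmatrix}$ with $u\in\mathbb R_{>0}$, $v\in\mathbb C$. The singular values of $g$ are the eigenvalues of $(gg^* )^{1/2}$. *)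

(* Defs.v *)
From HB Require Import structures.
From mathcomp Require Import all_boot all_order all_algebra.
From mathcomp Require Import complex.
From mathcomp Require Import reals sequences exp.

Set Implicit Arguments.
Unset Strict Implicit.
Unset Printing Implicit Defensive.

Import Order.TTheory GRing.Theory Num.Theory.

Local Open Scope ring_scope.
Local Open Scope sesquilinear_scope.
Local Open Scope complex_scope.

Definition SU2star (R : realType) (g : 'M[R[i]]_2) : Prop :=
  exists (u : R) (v : R[i]), 0 < u /\
    g = block_mx u%:C%:M 0
                 v%:M    (u^-1)%:C%:M :> 'M[R[i]]_(1 + 1).

(* In the order of R[i], 0 <= z means that z is real and nonnegative. *)
Definition psdmx (R : realType) (n : nat) (P : 'M[R[i]]_n) : Prop :=
  P \is hermsymmx /\ forall x : 'cV[R[i]]_n, 0 <= (x ^t* *m P *m x) 0 0.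

(* A positive semidefinite matrix has exactly one positive semidefinite square
   root, so this relation says P = M^(1/2). *)
Definition is_sqrtmx (R : realType) (n : nat) (M P : 'M[R[i]]_n) : Prop :=
  psdmx P /\ P *m P = M.

(* The eigenvalues of (g g^* )^(1/2), counted with multiplicity, form the
   list l (in any order). *)
Definition singular_values (R : realType) (n : nat) (g : 'M[R[i]]_n)
    (l : seq R) : Prop :=
  exists P : 'M[R[i]]_n,
    is_sqrtmx (g *m g ^t*) P /\
    char_poly P = \prod_(a <- l) ('X - (a%:C)%:P).

Definition multiplicative_multiple_Horn2 (R : realType)
    (s lambda mu nu rho sigma tau : R) : Prop :=
  let sv (g : 'M[R[i]]_2) (x : R) :=
    singular_values g [:: expR (s * x); expR (- (s * x))] in
  exists A B C : 'M[R[i]]_2,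
    [/\ SU2star A, SU2star B & SU2star C] /\
    [/\ sv A lambda, sv B mu & sv C nu] /\
    [/\ sv (A *m B) rho, sv (B *m C) sigma & sv (A *m B *m C) tau].

(* Main.v *)
Require Import Defs.
From HB Require Import structures.
From mathcomp Require Import all_boot all_order all_algebra.
From mathcomp Require Import complex.
From mathcomp Require Import reals sequences exp.
From mathcomp Require Import ring lra.

Set Implicit Arguments.
Unset Strict Implicit.
Unset Printing Implicit Defensive.

Import Order.TTheory GRing.Theory Num.Theory.

Local Open Scope ring_scope.

(** Write ['] for the exchange of the two indices and put [P = AB], [Q = BC],
    [T = ABC]. For 2x2 matrices the Pluecker relation reads
    [A_ik C_jl det B = +- (T_il B_k'j' - P_ij' Q_k'l)].
    When [det B = 1], each of the three families of sixteen products is thus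
    entrywise bounded by the sum of the other two, so each of the squared
    Frobenius norms [|A|^2 |C|^2], [|B|^2 |T|^2], [|P|^2 |Q|^2] is at most twice
    the sum of the other two. As the squared Frobenius norm of a matrix with
    singular values [e^x, e^-x], [x >= 0], lies between [e^(2x)] and
    [2 e^(2x)], this gives the inequalities, even with [log 4] for [log 16]. *)

Lemma det_mx2 (R : comNzRingType) (A : 'M[R]_2) :
  \det A = A 0 0 * A 1 1 - A 0 1 * A 1 0.
Proof.
rewrite (expand_det_row _ 0) !big_ord_recl big_ord0 /cofactor !det_mx11 !mxE /=.
have -> : lift ord0 ord0 = 1 :> 'I_2 by apply/val_inj.
have -> : lift 1 0 = 0 :> 'I_2 by apply/val_inj.
by rewrite /=; ring.
Qed.

(** In the bracket, [A i x * C y l] has as coefficient the minor of [B] on rows [x], [rev_ord k] and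
    columns [y], [rev_ord j]. A repeated row or column kills it, so only [x = k], [y = j] survives,
    with minor [\det B] up to sign. *)
Lemma plucker_mx2 (R : comNzRingType) (A B C : 'M[R]_2) (i k j l : 'I_2) :
  A i k * C j l * \det B =
  (-1) ^+ (k + j) * ((A *m B *m C) i l * B (rev_ord k) (rev_ord j)
                     - (A *m B) i (rev_ord j) * (B *m C) (rev_ord k) l).
Proof.
have r0 : rev_ord (0 : 'I_2) = 1 by apply/val_inj.
have r1 : rev_ord (1 : 'I_2) = 0 by apply/val_inj.
have o2 (m : 'I_2) : m = 0 \/ m = 1.
  by case: m => [[|[|//]] ?]; [left | right]; apply/val_inj.
rewrite det_mx2 !mxE !big_ord_recl !big_ord0 !mxE !big_ord_recl !big_ord0.
have -> : lift ord0 ord0 = 1 :> 'I_2 by apply/val_inj.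
have -> : ord0 = 0 :> 'I_2 by [].
by case: (o2 k) => ->; case: (o2 j) => ->; rewrite ?r0 ?r1 /=; ring.
Qed.

Section Frobenius.
Variable K : numDomainType.

Definition frobenius2 (m n : nat) (A : 'M[K]_(m, n)) : K :=
  \sum_(p : 'I_m * 'I_n) `|A p.1 p.2| ^+ 2.

(** The free choice of [f] lets the three products of norms run over one common index, so that they
    can be compared term by term. *)
Lemma frobenius2M (n : nat) (A B : 'M[K]_n)
    (f : ('I_n * 'I_n) * ('I_n * 'I_n) -> ('I_n * 'I_n) * ('I_n * 'I_n)) :
  injective f ->
  frobenius2 A * frobenius2 B =
  \sum_t `|A (f t).1.1 (f t).1.2 * B (f t).2.1 (f t).2.2| ^+ 2.
Proof.
move=> f_inj; rewrite /frobenius2 big_distrlr pair_big /=.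
rewrite (reindex_inj f_inj); apply: eq_bigr => t _.
by rewrite normrM exprMn.
Qed.

Lemma sum_sqr_norm_le (I : finType) (f g h : I -> K) :
  (forall t, `|f t| <= `|g t| + `|h t|) ->
  \sum_t `|f t| ^+ 2 <= 2 * (\sum_t `|g t| ^+ 2 + \sum_t `|h t| ^+ 2).
Proof.
move=> fgh; rewrite -big_split mulr_sumr; apply: ler_sum => t _ /=.
apply: (@le_trans _ _ ((`|g t| + `|h t|) ^+ 2)).
  by rewrite lerXn2r // nnegrE // addr_ge0.
(* The order of [K] may be partial: the square below is nonnegative because norms are real. *)
rewrite -subr_ge0.
have -> : 2 * (`|g t| ^+ 2 + `|h t| ^+ 2) - (`|g t| + `|h t|) ^+ 2
          = (`|g t| - `|h t|) ^+ 2 by ring.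
by rewrite real_exprn_even_ge0 // rpredB // normr_real.
Qed.

Lemma frobenius2_plucker (A B C : 'M[K]_2) : \det B = 1 ->
  let x := frobenius2 A * frobenius2 C in
  let y := frobenius2 B * frobenius2 (A *m B *m C) in
  let z := frobenius2 (A *m B) * frobenius2 (B *m C) in
  [/\ x <= 2 * (y + z), y <= 2 * (x + z) & z <= 2 * (x + y)].
Proof.
move=> detB x y z.
(* For [t = ((i, k), (j, l))], [swap] gives the entries of [B] and [ABC] in the Pluecker relation,
   and [cross] those of [AB] and [BC]. The inverse of [swap] is [swap']; [cross] is an
   involution. *)
pose swap (t : ('I_2 * 'I_2) * ('I_2 * 'I_2)) :=
  ((rev_ord t.1.2, rev_ord t.2.1), (t.1.1, t.2.2)).
pose cross (t : ('I_2 * 'I_2) * ('I_2 * 'I_2)) :=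
  ((t.1.1, rev_ord t.2.1), (rev_ord t.1.2, t.2.2)).
pose swap' (t : ('I_2 * 'I_2) * ('I_2 * 'I_2)) :=
  ((t.2.1, rev_ord t.1.1), (rev_ord t.1.2, t.2.2)).
have swap_inj : injective swap.
  by apply: (@can_inj _ _ _ swap') => -[[? ?] [? ?]]; rewrite /swap' /= !rev_ordK.
have cross_inj : injective cross.
  by apply: inv_inj => -[[? ?] [? ?]]; rewrite /cross /= !rev_ordK.
rewrite {}/x {}/y {}/z (frobenius2M _ _ (@inj_id _)) (frobenius2M _ _ swap_inj).
rewrite (frobenius2M _ _ cross_inj) /=.
have plucker i k j l : exists2 e : K, `|e| = 1 &
    e * (A i k * C j l) = B (rev_ord k) (rev_ord j) * (A *m B *m C) i l
      - (A *m B) i (rev_ord j) * (B *m C) (rev_ord k) l.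
  exists ((-1) ^+ (k + j)); first by rewrite normrX normrN1 expr1n.
  move: (plucker_mx2 A B C i k j l); rewrite detB mulr1 => ->.
  by rewrite signrMK [_ * B _ _]mulrC.
split; apply: sum_sqr_norm_le => -[[i k] [j l]] /=;
  have [e e1 E] := plucker i k j l.
- by rewrite -[leLHS]mul1r -e1 -normrM E ler_normB.
- move/eqP: E; rewrite eq_sym subr_eq => /eqP ->.
  by rewrite (le_trans (ler_normD _ _)) // [`|e * _|]normrM e1 mul1r.
(* Triangle inequality for [- v = - u + (u - v)]. *)
- rewrite addrC -[`|A i k * _|]mul1r -e1 -normrM E.
  set u := B _ _ * _; set v := (A *m B) _ _ * _.
  by have := ler_normD (- u) (u - v); rewrite addKr !normrN.
Qed.

End Frobenius.

Local Open Scope sesquilinear_scope.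
Local Open Scope complex_scope.

Lemma mxtrace_mul_adj (K : numClosedFieldType) (m n : nat) (A : 'M[K]_(m, n)) :
  \tr (A *m A ^t*) = frobenius2 A.
Proof.
rewrite /frobenius2 -(pair_bigA _ (fun i j => `|A i j| ^+ 2)).
apply: eq_bigr => i _; rewrite !mxE; apply: eq_bigr => j _.
by rewrite !mxE normCK.
Qed.

Lemma mxtrace_sqr2 (R : comNzRingType) (P : 'M[R]_2) :
  \tr (P *m P) = \tr P ^+ 2 - 2 * \det P.
Proof.
rewrite det_mx2 /mxtrace !big_ord_recl !big_ord0 !mxE !big_ord_recl !big_ord0.
have -> : lift ord0 ord0 = 1 :> 'I_2 by apply/val_inj.
have -> : ord0 = 0 :> 'I_2 by [].
by ring.
Qed.

(** The squared norm is [\tr (P *m P)], a polynomial in the trace and determinant of [P], which are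
    read off its characteristic polynomial without diagonalizing. *)
Lemma singular_values_frobenius2 (R : realType) (g : 'M[R[i]]_2) (a b : R) :
  singular_values g [:: a; b] -> frobenius2 g = (a ^+ 2 + b ^+ 2)%:C.
Proof.
move=> [P [[_ PP] charP]].
have E : char_poly P = 'X^2 - (a + b)%:C%:P * 'X + (a * b)%:C%:P.
  by rewrite charP !big_cons big_nil rmorphD rmorphM /= polyCD polyCM; ring.
have trP : \tr P = (a + b)%:C.
  apply/oppr_inj; rewrite -char_poly_trace // E.
  by rewrite !(coefD, coefN, coefXn, coefCM, coefX, coefC) /=; ring.
have detP : \det P = (a * b)%:C.
  have := char_poly_det P; rewrite E sqrrN expr1n mul1r => <-.
  by rewrite !(coefD, coefN, coefXn, coefCM, coefX, coefC) /=; ring.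
rewrite -mxtrace_mul_adj -PP mxtrace_sqr2 trP detP.
by rewrite !(rmorphD, rmorphM, rmorphXn) /=; ring.
Qed.

Lemma singular_values_expR_frobenius2 (R : realType) (g : 'M[R[i]]_2) (x : R) :
  0 <= x -> singular_values g [:: expR x; expR (- x)] ->
  exists2 N : R, frobenius2 g = N%:C & expR x ^+ 2 <= N <= 2 * expR x ^+ 2.
Proof.
move=> x0 /singular_values_frobenius2 ->; eexists; first by [].
have x_ge : expR (- x) <= expR x by rewrite ler_expR; lra.
have := expR_gt0 (- x); nra.
Qed.

Lemma SU2star_det (R : realType) (g : 'M[R[i]]_2) : SU2star g -> \det g = 1.
Proof.
move=> [u [v [u0 ->]]].
rewrite (@det_lblock _ 1 1) !det_scalar1 -rmorphM /= mulfV ?gt_eqF //.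
Qed.

(** With [m] the maximum, the hypothesis gives [expR (s * x) ^+ 2 <= 16 * expR (s * m) ^+ 2], so
    [expR (s * x)] is at most [4 * expR (s * m)], and strictness comes from [4 < 16]. *)
Lemma lt_max_add_ln16 (R : realType) (s x y z : R) : 0 < s ->
  expR (s * x) ^+ 2 <= 8 * (expR (s * y) ^+ 2 + expR (s * z) ^+ 2) ->
  x < Num.max y z + s^-1 * ln 16.
Proof.
move=> s0 H; rewrite -(ltr_pM2l s0) mulrDr mulVKf ?gt_eqF //.
rewrite -ltr_expR expRD lnK ?posrE //.
have le_exp w : w <= Num.max y z -> expR (s * w) <= expR (s * Num.max y z).
  by move=> ?; rewrite ler_expR ler_pM2l.
have := le_exp y; rewrite le_max lexx => /(_ isT) Hy.
have := le_exp z; rewrite le_max lexx orbT => /(_ isT) Hz.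
have := expR_gt0 (s * x); have := expR_gt0 (s * y); have := expR_gt0 (s * z).
nra.
Qed.

Theorem propositionA3 (R : realType) (s lambda mu nu rho sigma tau : R)
    (hs : 0 < s)
    (hlambda : 0 <= lambda) (hmu : 0 <= mu) (hnu : 0 <= nu)
    (hrho : 0 <= rho) (hsigma : 0 <= sigma) (htau : 0 <= tau)
    (hHorn : multiplicative_multiple_Horn2 s lambda mu nu rho sigma tau) :
  let alpha := lambda + nu in
  let beta := mu + tau in
  let gamma := rho + sigma in
  [/\ alpha < Num.max beta gamma + s^-1 * ln 16,
      beta < Num.max alpha gamma + s^-1 * ln 16
    & gamma < Num.max alpha beta + s^-1 * ln 16].
Proof.
move=> alpha beta gamma.
have [A [B [C [[_ hB _] [[svA svB svC] [svP svQ svT]]]]]] := hHorn.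
have := frobenius2_plucker A C (SU2star_det hB).
have sM x : 0 <= x -> 0 <= s * x by move=> ?; rewrite mulr_ge0 // ltW.
have [a -> ha] := singular_values_expR_frobenius2 (sM _ hlambda) svA.
have [b -> hb] := singular_values_expR_frobenius2 (sM _ hmu) svB.
have [c -> hc] := singular_values_expR_frobenius2 (sM _ hnu) svC.
have [p -> hp] := singular_values_expR_frobenius2 (sM _ hrho) svP.
have [q -> hq] := singular_values_expR_frobenius2 (sM _ hsigma) svQ.
have [t -> ht] := singular_values_expR_frobenius2 (sM _ htau) svT.
(* All norms are now real, so the inequalities descend from [R[i]] to [R]. *)
have two : 2 = 2%:C :> R[i] by rewrite rmorph_nat.
rewrite /= two -!(rmorphM, rmorphD) /= !lecR => -[Hx Hy Hz].
have prod x y (m n : R) :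
    expR (s * x) ^+ 2 <= m <= 2 * expR (s * x) ^+ 2 ->
    expR (s * y) ^+ 2 <= n <= 2 * expR (s * y) ^+ 2 ->
    expR (s * (x + y)) ^+ 2 <= m * n <= 4 * expR (s * (x + y)) ^+ 2.
  move=> /andP[m1 m2] /andP[n1 n2]; rewrite mulrDr expRD exprMn.
  have x0 := sqr_ge0 (expR (s * x)); have y0 := sqr_ge0 (expR (s * y)).
  rewrite ler_pM //=.
  have -> : 4 * (expR (s * x) ^+ 2 * expR (s * y) ^+ 2) =
    2 * expR (s * x) ^+ 2 * (2 * expR (s * y) ^+ 2) by ring.
  by rewrite ler_pM // ?(le_trans x0 m1) ?(le_trans y0 n1).
have /andP[] := prod _ _ _ _ ha hc; have /andP[] := prod _ _ _ _ hb ht.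
have /andP[] := prod _ _ _ _ hp hq; rewrite -/alpha -/beta -/gamma => *.
(* The lower bound of [prod] serves the left side and its upper bounds the right; the constant is
   [8 = 2 * 4]. *)
by split; apply: lt_max_add_ln16 => //; lra.
Qed.
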